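(* For every $n_0$ there exists a $k$-regular graph $G$ of order $n>n_0$ such that $$n^{2/3}-\tfrac13 n^{1/3}<k<n^{2/3}$$ and $$\|G\|_*=k+\sqrt{k(n-k)(n-1)}.$$
   Context: Graphs are finite, simple and undirected; the order of a graph is its number of vertices. The energy $\|G\|_*$ of a graph $G$ is the sum of the absolute values of the eigenvalues of its adjacency matrix (counted with multiplicity). *)

(* Defs.v *)
From HB Require Import structures.
From mathcomp Require Import all_boot all_order all_algebra.
From mathcomp Require Import all_classical all_reals all_analysis.

Set Implicit Arguments.
Unset Strict Implicit.
Unset Printing Implicit Defensive.

Import Order.TTheory GRing.Theory Num.Theory.

Local Open Scope classical_set_scope.
Local Open Scope ring_scope.

Record sgraph (T : finType) := SGraph {
  adj :> rel T;
  adj_sym : symmetric adj;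
  adj_irr : irreflexive adj
}.

Definition regular (T : finType) (G : sgraph T) (k : nat) : Prop :=
  forall x : T, #|[set y | G x y]%SET| = k.

Definition adjmx (R : realType) (T : finType) (G : sgraph T) : 'M[R]_#|T| :=
  \matrix_(i, j) (G (enum_val i) (enum_val j))%:R.

(* The sum runs over the set of distinct eigenvalues, each weighted by its
   multiplicity as a root of the characteristic polynomial.  All eigenvalues
   are real, since the adjacency matrix is symmetric.  A sum over a classical
   set is 0 when its support is infinite, which cannot happen here. *)
Definition energy (R : realType) (T : finType) (G : sgraph T) : R :=
  \sum_(x \in [set x : R | eigenvalue (adjmx R G) x])
    (mup x (char_poly (adjmx R G)))%:R * `|x|.

(* Main.v *)
Require Import Defs.
From HB Require Import structures.
From mathcomp Require Import all_boot all_order all_algebra.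
From mathcomp Require Import all_classical all_reals all_analysis.
From mathcomp Require Import ring lra.

(** A k-regular graph on n vertices whose adjacency matrix A has all its
    nontrivial eigenvalues of the same absolute value attains the stated
    energy.  This happens as soon as any two distinct vertices, adjacent or
    not, have the same number l of common neighbours, because then
    A^2 = (k - l) I + l J with J the all-ones matrix: the vertices and their
    neighbourhoods form a symmetric 2-(n, k, l) design.

    To read the multiplicities off this equation, multiply the characteristic
    polynomial p of A by p(-X).  The product is
    det (A^2 - X^2) = det ((k - l - X^2) I + l J), a rank-one perturbation of a
    scalar matrix, hence equal to (k - l - X^2)^(n-1) (k^2 - X^2).  So, with
    r = sqrt (k - l), the multiplicities of k and -k in p add up to 1, those of
    r and -r add up to n - 1, and p has no other root
    ([mup_char_poly_sym]).  The energy is k + (n - 1) r whatever the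
    signs are, and (n - 1)(k - l) = k (n - k) turns this into
    k + sqrt (k (n - k) (n - 1)) ([energy_symmetric_design]).

    It remains to find such graphs with k just below n^(2/3).  Following
    Wallis and Fon-Der-Flaass, take q + 2 copies of the affine plane of order q,
    indexed by a set I.  For each copy i, the q + 1 other copies are put in
    bijection with the q + 1 parallel classes of the plane
    ([class_of]).  The points x of copy i and y of copy j != i are joined when
    the line through x in the class that i assigns to j corresponds to the line
    through y in the class that j assigns to i.  Then n = q^2 (q + 2),
    k = q (q + 1) and l = q:
    - two points of the same copy lie on one common line, which belongs to the
      class of exactly one other copy h, and their common neighbours are the q
      points of a line of h;
    - two points of different copies i and j have, in every third copy h, one
      common neighbour, the intersection of two lines of different classes;
      there are q such copies.

    With t = n^(1/3), the expansion t = q + 2/3 - 4/(9 q) + ... gives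
    t^2 = q^2 + 4 q / 3 + O(1) and t^2 - t / 3 = q^2 + q - 2/3 + O(1/q), so that
    k = q^2 + q lies in the window ([degree_window]).  Taking q prime and
    arbitrarily large concludes. *)

Set Implicit Arguments.
Unset Strict Implicit.
Unset Printing Implicit Defensive.

Import Order.TTheory GRing.Theory Num.Theory.

Local Open Scope ring_scope.

(** * A determinant and the symmetrized characteristic polynomial *)

(** The bordered matrix [M] is triangularized on either side; its two
    evaluations are compared.  The factor [a] on the left avoids assuming
    that [a] is invertible. *)
Lemma det_scalar_add_rank1 (D : comNzRingType) n (a : D) (u : 'cV[D]_n)
    (v : 'rV[D]_n) :
  a * \det (a%:M + u *m v) = a ^+ n * (a + (v *m u) 0 0).
Proof.
pose M := block_mx a%:M (- u) v 1%:M.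
have detM : \det M = \det (a%:M + u *m v).
  transitivity (\det (M *m block_mx 1%:M 0 (- v) 1%:M)).
    by rewrite det_mulmx det_lblock !det1 !mulr1.
  rewrite mulmx_block !mulmx0 !add0r !mulmx1 !mul1mx mulNmx mulmxN opprK.
  by rewrite subrr det_ublock det1 mulr1.
have : \det (block_mx 1%:M 0 (- v) a%:M *m M) = a ^+ n * (a + (v *m u) 0 0).
  rewrite mulmx_block !mul1mx !mul0mx !addr0 mulmx1 mulmxN !mulNmx opprK.
  rewrite -scalar_mxC addNr det_ublock det_scalar.
  by rewrite det_mx11 !mxE eqxx mulr1n addrC.
by rewrite det_mulmx det_lblock det1 mul1r det_scalar expr1 detM.
Qed.

Lemma det_scalar_add_const (D : idomainType) n (a b : D) :
  a != 0 -> (0 < n)%N ->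
  \det (a%:M + const_mx b : 'M[D]_n) = a ^+ n.-1 * (a + b *+ n).
Proof.
move=> a0 n0; apply: (mulfI a0); rewrite mulrA -exprS prednK //.
have -> : const_mx b = (const_mx 1 : 'cV_n) *m const_mx b :> 'M[D]_n.
  by apply/matrixP=> i j; rewrite !mxE big_ord1 !mxE mul1r.
rewrite det_scalar_add_rank1; congr (_ * (_ + _)).
rewrite mxE (eq_bigr (fun=> b)) => [|i _]; last by rewrite !mxE mulr1.
by rewrite sumr_const card_ord.
Qed.

(** Substitution of -X is an involution that exchanges the factors X - x and
    X + x up to sign, so one inequality between multiplicities suffices. *)
Lemma mup_comp_polyNX (F : fieldType) (p : {poly F}) x : p != 0 ->
  mup x (p \Po - 'X) = mup (- x) p.
Proof.
have NXK (q : {poly F}) : (q \Po - 'X) \Po - 'X = q.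
  by rewrite -comp_polyA rmorphN /= comp_polyX opprK comp_polyXr.
have le_mup y (q : {poly F}) : q != 0 ->
    (mup y q <= mup (- y) (q \Po - 'X))%N.
  move=> q0; have q'0 : q \Po - 'X != 0.
    by apply: contra_neq q0 => q'0; rewrite -[q]NXK q'0 comp_poly0.
  rewrite mup_geq //.
  have : ('X - y%:P) ^+ mup y q %| q by rewrite -mup_geq.
  move=> /(dvdp_comp_poly (- 'X)); rewrite rmorphXn /= rmorphB /=.
  rewrite comp_polyX comp_polyC -opprD exprNn polyCN opprK.
  exact/dvdp_trans/dvdp_mulIr.
move=> p0; have p'0 : p \Po - 'X != 0.
  by apply: contra_neq p0 => p'0; rewrite -[p]NXK p'0 comp_poly0.
apply/eqP; rewrite eqn_leq; apply/andP; split.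
  by have := le_mup x _ p'0; rewrite NXK.
by have := le_mup (- x) _ p0; rewrite opprK.
Qed.

(** This is det (X - A) det (- X - A); it brings in only the square of [A],
    which for the graphs below is much simpler than [A]. *)
Lemma char_poly_comp_polyNX (F : comNzRingType) n (A : 'M[F]_n) :
  char_poly A * (char_poly A \Po - 'X)
  = \det (map_mx polyC (A *m A) - ('X ^+ 2)%:M).
Proof.
rewrite /char_poly -[X in _ * X]det_map_mx -det_mulmx; congr (\det _).
have -> : map_mx (comp_poly (- 'X)) (char_poly_mx A)
    = - ('X%:M + map_mx polyC A).
  apply/matrixP=> i j; rewrite !mxE rmorphB rmorphMn /= comp_polyX comp_polyC.
  by rewrite mulNrn opprD.
rewrite /char_poly_mx mulmxN mulmxBl !mulmxDr -scalar_mxC -scalar_mxM map_mxM.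
by rewrite scalar_mxC addrKA opprB expr2.
Qed.

(** * Energy of a graph with constant codegree *)

Section Design.
Variables (R : realType) (T : finType) (G : sgraph T) (k l : nat).
Hypotheses (T_gt0 : (0 < #|T|)%N) (l_gt0 : (0 < l)%N) (lt_lk : (l < k)%N).
Hypothesis regG : regular G k.
Hypothesis codegG :
  forall x y, x != y -> #|[set z | G x z && G z y]%SET| = l.

Let A : 'M[R]_#|T| := adjmx R G.

(** Entry (x, y) of the square counts the walks of length 2 from x to y. *)
Lemma adjmx_sqr : A *m A = ((k - l)%N%:R)%:M + const_mx l%:R.
Proof.
apply/matrixP=> i j; rewrite !mxE.
pose c x y := #|[set z | G x z && G z y]%SET|.
transitivity ((c (enum_val i) (enum_val j))%:R : R).
  rewrite /c -sum1_card natr_sum [RHS]big_mkcond /=.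
  rewrite [RHS](reindex (fun h : 'I_#|T| => enum_val h)) /=; last first.
    exact/onW_bij/enum_val_bij.
  by apply: eq_bigr => h _; rewrite !mxE inE; do 2![case: (G _ _)];
     rewrite ?(mulr0, mul0r, mulr1).
have [<-|ij] := eqVneq i j; last first.
  by rewrite mulr0n add0r /c codegG // (inj_eq enum_val_inj).
rewrite mulr1n -natrD subnK 1?ltnW // -(regG (enum_val i)).
by congr (_%:R); apply: eq_card => z; rewrite !inE (adj_sym G z) andbb.
Qed.

(** Double counting of the walks of length 2 that start at a fixed vertex. *)
Lemma degree_sqr : (k * k = (k - l) + l * #|T|)%N.
Proof.
have /card_gt0P[x _] := T_gt0.
have : (\sum_(y : T) #|[set z | G x z && G z y]%SET| = k * k)%N.
  under eq_bigr do rewrite -sum1_card.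
  rewrite (exchange_big_dep (fun z => G x z)) /=; last first.
    by move=> y z _; rewrite inE => /andP[].
  rewrite (eq_bigr (fun=> k)) => [|z xz].
    by rewrite sum_nat_const; congr (_ * _)%N; rewrite -(regG x) cardsE.
  rewrite sum1dep_card -(regG z); apply: eq_card => y.
  by rewrite !inE xz.
rewrite (bigD1 x) //= (eq_bigr (fun=> l)) => [|y yx]; last first.
  by rewrite codegG // eq_sym.
have -> : [set z | G x z && G z x]%SET = [set z | G x z]%SET.
  by apply/setP => z; rewrite !inE (adj_sym G z) andbb.
rewrite regG sum_nat_const cardC1 => <-.
by rewrite -{2}(prednK T_gt0) mulnS addnA subnK 1?ltnW // mulnC.
Qed.

Let p : {poly R} := char_poly A.
(* The square of the adjacency matrix acts as k - l on the vectors of sum zero,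
   so the nontrivial eigenvalues are r or - r. *)
Let r : R := Num.sqrt (k - l)%N%:R.

Lemma nontrivial_eigenvalue_sqr : r ^+ 2 = (k - l)%N%:R.
Proof. by rewrite sqr_sqrtr. Qed.

Lemma char_poly_sym_factor :
  p * (p \Po - 'X) = (-1) ^+ #|T| *
    ((('X - r%:P) * ('X - (- r)%:P)) ^+ #|T|.-1 *
     (('X - k%:R%:P) * ('X - (- k%:R)%:P))).
Proof.
rewrite char_poly_comp_polyNX adjmx_sqr.
have -> : map_mx polyC (((k - l)%N%:R)%:M + const_mx l%:R) - ('X ^+ 2)%:M
    = ((r ^+ 2)%:P - 'X ^+ 2)%:M + const_mx (l%:R)%:P :> 'M[{poly R}]_#|T|.
  apply/matrixP=> i j; rewrite !mxE nontrivial_eigenvalue_sqr polyCD polyCMn.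
  by case: (i == j); rewrite ?mulr1n ?mulr0n ?subr0 1?addrAC.
rewrite det_scalar_add_const //; last first.
  by rewrite -size_poly_eq0 addrC size_polyDl ?size_polyN ?size_polyXn //
    (leq_ltn_trans (size_polyC_leq1 _)).
have -> : (r ^+ 2)%:P - 'X ^+ 2 = - 1 * (('X - r%:P) * ('X - (- r)%:P)).
  by rewrite polyCN polyC_exp; ring.
(* This is where k^2 = (k - l) + l n makes k and - k the remaining roots. *)
have -> : - 1 * (('X - r%:P) * ('X - (- r)%:P)) + l%:R%:P *+ #|T| =
   - 1 * (('X - k%:R%:P) * ('X - (- k%:R)%:P)).
  have : (r ^+ 2)%:P + l%:R%:P *+ #|T| = (k%:R)%:P ^+ 2 :> {poly R}.
    by rewrite -polyCMn -polyCD nontrivial_eigenvalue_sqr -polyC_exp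
      -mulrnA -natrD -degree_sqr natrM.
  by rewrite polyC_exp !polyCN => /(canRL (addKr _)) ->; ring.
by rewrite exprMn -{3}(prednK T_gt0) exprS; ring.
Qed.

(** Only the sum of the multiplicities of x and - x is determined here, which
    is all that a sum of absolute values sees. *)
Lemma mup_char_poly_sym x :
  (mup x p + mup (- x) p
   = ((r == x) + (- r == x)) * #|T|.-1 + ((k%:R == x) + (- k%:R == x)))%N.
Proof.
have p0 : p != 0 by rewrite monic_neq0 // char_poly_monic.
have p'0 : p \Po - 'X != 0.
  have : p * (p \Po - 'X) != 0.
    rewrite char_poly_sym_factor.
    by rewrite !(mulf_neq0, expf_neq0, polyXsubC_eq0) ?oppr_eq0 ?oner_eq0.
  by rewrite mulf_eq0 negb_or => /andP[].
rewrite -(mup_comp_polyNX _ p0) -mupM // char_poly_sym_factor mupMr; last first.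
  by rewrite -polyCN -polyC_exp rootC signr_eq0.
rewrite exprMn !mupM ?(mulf_neq0, expf_neq0, polyXsubC_eq0) //.
have mupX y : mup x ('X - y%:P) = (y == x).
  by rewrite (mup_XsubCX 1); case: eqP.
by rewrite !mupX !mup_XsubCX; do 2!case: eqP => _;
   rewrite ?mul0n ?mul1n ?mulnDl ?mul1n ?addn0.
Qed.

(** The roots k, - k contribute k in total, and r, - r contribute
    (n - 1) r.  The assumption 0 < l < k makes these four numbers distinct. *)
Lemma energy_symmetric_design :
  energy R G = k%:R + Num.sqrt (k%:R * (#|T|%:R - k%:R) * (#|T|%:R - 1)).
Proof.
have k_gt0 : 0 < k%:R :> R by rewrite ltr0n (leq_ltn_trans (leq0n l)).
have r_gt0 : 0 < r by rewrite sqrtr_gt0 ltr0n subn_gt0.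
have lt_rk : r < k%:R.
  rewrite -(@ltr_pXn2r _ 2) ?nnegrE ?ltW //
    nontrivial_eigenvalue_sqr -natrX ltr_nat.
  by rewrite (@leq_trans k) ?ltn_subrL ?l_gt0 ?(leq_trans _ lt_lk) //
    leq_pmulr ?(leq_trans _ lt_lk).
have mup_k : (mup k%:R p + mup (- k%:R) p = 1)%N.
  by rewrite mup_char_poly_sym eqxx !lt_eqF //; lra.
have mup_r : (mup r p + mup (- r) p = #|T|.-1)%N.
  rewrite mup_char_poly_sym eqxx.
  have -> : (- r == r) = false by apply/lt_eqF; lra.
  have -> : (k%:R == r) = false by apply/gt_eqF; lra.
  have -> : (- k%:R == r) = false by apply/lt_eqF; lra.
  by rewrite /= !addn0 mul1n.
have sub_roots : ([set x : R | eigenvalue A x] `<=`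
    [set` [:: k%:R; - k%:R; r; - r]])%classic.
  move=> x /=; rewrite eigenvalue_root_char !inE => px.
  have : (0 < mup x p + mup (- x) p)%N.
    by rewrite addn_gt0 -XsubC_dvd ?dvdp_XsubCl ?px // monic_neq0 //
      char_poly_monic.
  rewrite mup_char_poly_sym ![x == _]eq_sym.
  by do 4![case: eqP => // _].
rewrite /energy (fsbig_fwiden [:: k%:R; - k%:R; r; - r]) //; last 2 first.
- rewrite /= !inE !negb_or !andbT.
  by do ![apply/andP; split]; apply/eqP => ?; lra.
- move=> x [_ /=]; rewrite eigenvalue_root_char => /negP px.
  by rewrite mupNroot ?mul0r.
rewrite !big_cons big_nil /= addr0 !normrN !gtr0_norm // addrA -!mulrDl -!natrD.
rewrite mup_k mup_r mul1r; congr (_ + _).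
have n_ge1 : 1 <= #|T|%:R :> R by rewrite ler1n.
(* Hence the expression under the square root is ((n - 1) r)^2. *)
have -> : k%:R * (#|T|%:R - k%:R) = (#|T|%:R - 1) * r ^+ 2 :> R.
  have : (k * k)%N%:R = ((k - l) + l * #|T|)%N%:R :> R by rewrite degree_sqr.
  rewrite nontrivial_eigenvalue_sqr natrD !natrM natrB ?(ltnW lt_lk) //; lra.
rewrite -[LHS]ger0_norm ?mulr_ge0 ?ler0n ?ltW // -sqrtr_sqr; congr Num.sqrt.
by rewrite -subn1 natrB //; ring.
Qed.

End Design.

(** * Copies of an affine plane *)

Lemma card_set_pair (I S : finType) (P : I -> S -> bool) :
  #|[set w : I * S | P w.1 w.2]%SET| = (\sum_h #|[set z | P h z]%SET|)%N.
Proof.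
rewrite -sum1dep_card.
rewrite -(pair_big_dep (fun _ : I => true) P (fun _ _ => 1%N)) /=.
by apply: eq_bigr => h _; rewrite sum1dep_card.
Qed.

Section Plane.
Variable F : finFieldType.

(** [Some m] stands for the parallel class of the lines of slope [m] and [None]
    for the vertical one; within a class a line is identified by its
    intercept, which lets lines of different classes be matched by equality of
    their labels. *)
Definition line_label (c : option F) (x : F * F) : F :=
  if c is Some m then x.2 - m * x.1 else x.1.

Lemma card_line c a : #|[set z | line_label c z == a]%SET| = #|F|.
Proof.
(* A parametrization of the line of label a in the class d. *)
pose pt d t := if d is Some m then (t, a + m * t) else (a, t).
have pt_inj : injective (pt c) by rewrite /pt => s t; case: c => [m|] [].
rewrite -cardsT -(card_imset _ pt_inj); apply: eq_card => -[u v].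
rewrite inE; apply/eqP/imsetP => [|[t _ ->]];
  rewrite /pt; case: c {pt_inj} => [m|] /=.
- by move=> <-; exists u; rewrite ?inE ?subrK.
- by move=> <-; exists v; rewrite ?inE.
- by rewrite addrK.
- by [].
Qed.

Lemma card_line_meet c d a b : c != d ->
  #|[set z | (line_label c z == a) && (line_label d z == b)]%SET| = 1%N.
Proof.
pose pt := match c, d with
  | Some m, Some n => ((b - a) / (m - n), a + m * ((b - a) / (m - n)))
  | Some m, None => (b, a + m * b)
  | None, Some n => (a, b + n * a)
  | None, None => (0, 0) end.
move=> cd; rewrite -(cards1 pt); apply: eq_card => -[u v].
rewrite !inE /pt; case: c d cd {pt} => [m|] [n|] //= cd.
- have mn : m - n != 0 by rewrite subr_eq0; apply: contra cd => /eqP ->.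
  apply/andP/eqP => [[/eqP<- /eqP<-]|[-> ->]].
    by congr (_, _); field.
  by split; apply/eqP; field.
- apply/andP/eqP => [[/eqP<- /eqP<-]|[-> ->]]; first by rewrite subrK.
  by rewrite addrK !eqxx.
- apply/andP/eqP => [[/eqP<- /eqP<-]|[-> ->]]; first by rewrite subrK.
  by rewrite addrK !eqxx.
Qed.

Lemma card_line_through x y : x != y ->
  #|[set c | line_label c x == line_label c y]%SET| = 1%N.
Proof.
case: x y => [x1 x2] [y1 y2] xy.
pose c0 := if x1 == y1 then None else Some ((x2 - y2) / (x1 - y1)).
rewrite -(cards1 c0); apply: eq_card => c; rewrite !inE /c0.
have [e1|ne1] := eqVneq x1 y1; case: c => [m|] /=.
- rewrite e1 (inj_eq (addIr _)); apply/negP => /eqP e2.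
  by rewrite e1 e2 eqxx in xy.
- by rewrite e1 eqxx.
- have d0 : x1 - y1 != 0 by rewrite subr_eq0.
  apply/eqP/eqP => [e|[->]]; last by field.
  congr Some; apply: (mulIf d0).
  by rewrite divfK // -(subrK (m * x1) x2) e; ring.
- exact/negbTE.
Qed.

(** The copies are indexed by [option (option F)], one index more than there
    are parallel classes.  For fixed [i], the map [class_of i] is a bijection
    from the indices other than [i] to the classes: it strips the outer [Some],
    and sends the remaining index [None] to the class freed by [i]. *)
Definition class_of (i j : option (option F)) : option F :=
  if j is Some c then c else if i is Some d then d else None.

Lemma class_of_inj i j h :
  i != j -> i != h -> class_of i j = class_of i h -> j = h.
Proof.
by case: i j h => [i|] [j|] [h|] //= ij ih e; subst; rewrite ?eqxx in ij ih *.
Qed.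

Lemma class_of_surj i c : exists2 h, h != i & class_of i h = c.
Proof.
case: i => [d|]; last by exists (Some c).
by have [->|cd] := eqVneq c d; [exists None | exists (Some c)].
Qed.

Definition vertex := (option (option F) * (F * F))%type.

Definition plane_adj (u v : vertex) : bool :=
  (u.1 != v.1) &&
  (line_label (class_of u.1 v.1) u.2 == line_label (class_of v.1 u.1) v.2).

Lemma plane_adj_sym : symmetric plane_adj.
Proof.
move=> u v; rewrite /plane_adj [v.1 == _]eq_sym.
by congr (_ && _); exact: eq_sym.
Qed.

Lemma plane_adj_irr : irreflexive plane_adj.
Proof. by move=> u; rewrite /plane_adj eqxx. Qed.

Definition plane_graph := SGraph plane_adj_sym plane_adj_irr.

(** In each of the q + 1 other copies the neighbours of a point form a line. *)
Lemma plane_graph_regular : regular plane_graph (#|F| * #|F|.+1).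
Proof.
move=> [i x]; rewrite (card_set_pair (fun h z => plane_adj (i, x) (h, z))).
rewrite (bigD1 i) //= (eq_bigr (fun=> #|F|)) => [|h hi]; last first.
  rewrite -(card_line (class_of h i) (line_label (class_of i h) x)).
  by apply: eq_card => z; rewrite !inE /plane_adj /= eq_sym hi /= eq_sym.
rewrite sum_nat_const cardC1 !card_option /= mulnC.
by rewrite eq_card0 // => z; rewrite !inE /plane_adj /= eqxx.
Qed.

(** Two points of one copy share the q points of a single line, in the copy
    assigned to the class of the line joining them; two points of different
    copies share one point in each of the q remaining copies. *)
Lemma plane_graph_codegree u v : u != v ->
  #|[set w | plane_graph u w && plane_graph w v]%SET| = #|F|.
Proof.
move: u v => [i x] [j y] uv.
rewrite (card_set_pair (fun h z =>
  plane_adj (i, x) (h, z) && plane_adj (h, z) (j, y))).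
have [ij|ij] := eqVneq i j.
  subst j; have xy : x != y by apply: contra uv => /eqP ->.
  have /eqP/cards1P[c0 c0P] := card_line_through xy.
  have [h0 h0i h0c] := class_of_surj i c0.
  rewrite (bigD1 h0) //= big1 ?addn0 => [|h hh0]; last first.
    apply: eq_card0 => z; rewrite !inE /plane_adj /= [i == h]eq_sym.
    apply/negP => /andP[/andP[hi /eqP e1] /andP[_ /eqP e2]].
    have : class_of i h \in [set c0]%SET by rewrite -c0P inE e1 e2.
    rewrite inE -h0c => /eqP /class_of_inj e; move: hh0.
    by rewrite e ?eqxx // eq_sym.
  rewrite -(card_line (class_of h0 i) (line_label c0 x)).
  apply: eq_card => z; rewrite !inE /plane_adj /= [i == h0]eq_sym h0i h0c /=.
  have : c0 \in [set c0]%SET by rewrite inE.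
  by rewrite -c0P inE => /eqP <-; rewrite [_ == line_label _ z]eq_sym andbb.
(* q is rewritten as the number of indices other than i and j, so that both
   sides become sums over the third copies. *)
have := @sum1_card _ (@predT (option (option F))).
rewrite !card_option (bigD1 i) //= (bigD1 j) 1?eq_sym //= => -[<-].
rewrite (bigD1 i) //= (bigD1 j) 1?eq_sym //=.
rewrite !eq_card0 => [|z|z]; try by rewrite !inE /plane_adj /= eqxx ?andbF.
apply: eq_bigr => h /andP[hi hj].
have chij : class_of h i != class_of h j.
  by apply: contra ij => /eqP /class_of_inj ->.
rewrite -(card_line_meet (line_label (class_of i h) x)
  (line_label (class_of j h) y) chij).
apply: eq_card => z; rewrite !inE /plane_adj /= [i == h]eq_sym hi hj /=.
by rewrite [line_label _ x == _]eq_sym.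
Qed.

End Plane.

(** * Size of the degree, and the theorem *)

(** With s = q and t = n^(1/3), the upper bound is (s^2 + s)^3 < n^2.  For the
    lower bound, t^2 - t / 3 increases with t, so an upper bound on t is needed;
    t < s + 2/3 is not quite enough, as it leaves an excess of 2/9, and the
    correction e = 1 / (6 s) removes 2 s e = 1/3 from it. *)
Lemma degree_window (R : realType) (q : nat) : (0 < q)%N ->
  let n := (q.+2 * (q * q))%N%:R : R in
  n `^ (2 / 3) - 1 / 3 * n `^ (1 / 3) < (q * q.+1)%N%:R < n `^ (2 / 3).
Proof.
move=> q0 /=; set n := (_ * (q * q))%N%:R; set s : R := q%:R.
have s1 : 1 <= s by rewrite ler1n.
have nE : n = s ^+ 3 + 2 * s ^+ 2.
  by rewrite /n !natrM -addn2 natrD -/s; ring.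
have -> : (q * q.+1)%N%:R = s ^+ 2 + s by rewrite natrM -natr1 -/s; ring.
have n0 : 0 <= n by rewrite ler0n.
have -> : n `^ (2 / 3) = (n `^ (1 / 3)) ^+ 2.
  by rewrite -powR_mulrn ?powR_ge0 // -powRrM; congr (_ `^ _); field.
have : (n `^ (1 / 3)) ^+ 3 = n.
  by rewrite -powR_mulrn ?powR_ge0 // -powRrM mul1r mulVf // powRr1.
have := powR_ge0 n (1 / 3); move: (n `^ _) => t t0 t3.
have s0 : 0 < s by lra.
apply/andP; split; last first.
  rewrite -(@ltr_pXn2r _ 3) ?nnegrE ?exprn_ge0 //; last by nra.
  rewrite -exprM mulnC exprM t3 nE -subr_gt0.
  have -> : (s ^+ 3 + 2 * s ^+ 2) ^+ 2 - (s ^+ 2 + s) ^+ 3 =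
    s ^+ 3 * (s ^+ 2 - 1 + s) by ring.
  by rewrite mulr_gt0 ?exprn_gt0 //; nra.
pose e : R := s^-1 / 6.
have se : s * e = 1 / 6 by rewrite /e mulrA mulfV ?gt_eqF // mul1r.
have e0 : 0 < e by rewrite /e; apply: divr_gt0 => //; rewrite invr_gt0.
have e1 : e <= 1 / 6 by nra.
have lt_t : t < s + 2 / 3 - e.
  rewrite -(@ltr_pXn2r _ 3) ?nnegrE //; last by lra.
  rewrite t3 nE -subr_gt0.
  have -> : (s + 2 / 3 - e) ^+ 3 - (s ^+ 3 + 2 * s ^+ 2) =
    4 / 3 * s + 8 / 27 - 3 * s * (s * e) - 4 * (s * e) - 4 / 3 * e
    + 3 * (s * e) * e + 2 * e ^+ 2 - e ^+ 3 by field.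
  rewrite se; nra.
nra.
Qed.

Theorem proposition15 (R : realType) (n0 : nat) :
  exists (n k : nat) (T : finType) (G : sgraph T),
    [/\ #|T| = n,
        (n0 < n)%N,
        regular G k,
        n%:R `^ (2 / 3) - 1 / 3 * n%:R `^ (1 / 3) < (k%:R : R) < n%:R `^ (2 / 3)
      & energy R G
        = k%:R + Num.sqrt (k%:R * (n%:R - k%:R) * (n%:R - 1)) ].
Proof.
have [q lt_n0q q_pr] := prime_above n0.
have q0 := prime_gt0 q_pr.
have cF : #|'F_q| = q by rewrite card_Fp.
have cV : #|{: vertex 'F_q}| = (q.+2 * (q * q))%N.
  by rewrite card_prod card_prod !card_option cF.
have reg := @plane_graph_regular 'F_q; rewrite cF in reg.
exists (q.+2 * (q * q))%N, (q * q.+1)%N, (vertex 'F_q), (plane_graph 'F_q).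
split=> //.
- by rewrite (leq_trans lt_n0q) // mulnA leq_pmull // muln_gt0 q0.
- exact: degree_window.
- rewrite -cV; apply: (@energy_symmetric_design R _ _ _ q) => //.
  + by rewrite cV !muln_gt0 q0.
  + by rewrite ltn_Pmulr.
  + by move=> u v uv; rewrite plane_graph_codegree ?cF.
Qed.
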